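(* Let $T\colon c\to c$ be the Cesàro operator, and let $x=(x_k)_{k\ge0}\in c$ be such that $x_0=\lim_{k\to\infty}x_k$ and the series $\sum_{k=1}^\infty\frac{x_k-x_0}{k}$ converges. Then $\|T^nx-Px\|_\infty=O(n^{-1/2})$ as $n\to\infty$.
   Context: $c$ denotes the complex Banach space of convergent complex sequences $x=(x_k)_{k\ge0}$, endowed with the supremum norm $\|\cdot\|_\infty$. The Cesàro operator $T\colon c\to c$ is the bounded linear operator given by $(Tx)_k=\frac{1}{k+1}\sum_{j=0}^k x_j$ for $k\ge0$. The operator $P\colon c\to c$ is defined by $Px=x_0e_\infty$, where $e_\infty=(1,1,1,\dots)$. Convergence of the series means convergence of its partial sums (not necessarily absolute). *)

(* Defs.v *)
From HB Require Import structures.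
From mathcomp Require Import all_boot all_order all_algebra.
From mathcomp Require Import complex.
From mathcomp Require Import all_classical all_reals all_analysis.

Set Implicit Arguments.
Unset Strict Implicit.
Unset Printing Implicit Defensive.

Import Order.TTheory GRing.Theory Num.Theory.
Import numFieldNormedType.Exports.
Import Normc.

Local Open Scope classical_set_scope.
Local Open Scope ring_scope.
Local Open Scope complex_scope.

(* The topology on the complex numbers R[i] is the one of the normed module
   R[i]^o; its norm is R[i]-valued, and normc is the same modulus in R. *)

Lemma cvg_normcP (R : realType) (u : nat -> R[i]^o) (l : R[i]^o) :
  (u @ \oo --> l) <-> (normc (l - u n) @[n --> \oo] --> (0 : R)).
Proof.
split.
- move=> /cvgrPdist_lt ul; apply/cvgr0Pnorm_lt => e e0.
  have eC : 0 < e%:C :> R[i] by rewrite ltcR.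
  have := ul _ eC; apply: filterS => n /=.
  rewrite -[`|_|]/((normc (l - u n))%:C) ltcR.
  by rewrite ger0_norm //; case: (l - u n) => a b /=; exact: sqrtr_ge0.
- move=> /cvgr0Pnorm_lt ul; apply/cvgrPdist_lt => -[e e'] /andP[/= /eqP -> e0].
  have := ul _ e0; apply: filterS => n /=.
  rewrite -[`|(l - u n : R[i])|]/((normc (l - u n))%:C) => h.
  by rewrite -[e +i* 0]/(e%:C) ltcR (le_lt_trans (ler_norm _)).
Qed.

Definition cvg_seq (R : realType) : {pred nat -> R[i]^o} :=
  [pred x : nat -> R[i]^o | `[< cvgn x >]].

Lemma cvg_seq_submod_closed (R : realType) : submod_closed (@cvg_seq R).
Proof.
split; first by apply/asboolP; exact: is_cvg_cst.
move=> a x y /asboolP cx /asboolP cy; apply/asboolP.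
by exact: (@is_cvgD R[i] R[i]^o nat \oo _ (a *: x) y (is_cvgZr cx) cy).
Qed.

HB.instance Definition _ (R : realType) :=
  GRing.isSubmodClosed.Build _ _ (@cvg_seq R) (@cvg_seq_submod_closed R).

(* The complex vector space c of convergent complex sequences. *)
Record cseq (R : realType) := CSeq {
  cseq_val :> nat -> R[i]^o ;
  cseq_cvg : cseq_val \in @cvg_seq R }.

HB.instance Definition _ (R : realType) := [isSub for @cseq_val R].
HB.instance Definition _ (R : realType) := [Choice of cseq R by <:].
HB.instance Definition _ (R : realType) :=
  [SubChoice_isSubLmodule of cseq R by <:].

(* The set is nonempty and, for x in c, bounded (has_sup_normc below), so that
   sup is the actual least upper bound. *)
Definition supnorm (R : realType) (x : cseq R) : R :=
  sup (range (fun k => normc (x k))).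

Lemma has_sup_normc (R : realType) (x : cseq R) :
  has_sup (range (fun k => normc (x k))).
Proof.
split; first by exists (normc (x 0%N)); exists 0%N.
have /asboolP /cvg_ex[l /cvg_normcP xl] := cseq_cvg x.
have /cvg_seq_bounded/bounded_fun_has_ubound[M Mub] :
  cvgn (fun n => normc (l - x n)) by apply/cvg_ex; exists 0.
exists (normc l + M) => _ [k _ <-].
have -> : x k = l - (l - x k) :> R[i] by rewrite opprB addrC subrK.
rewrite (le_trans (le_normcD _ _)) // normcN lerD2l.
by apply: Mub; exists k.
Qed.

Definition cesaro_seq (R : realType) (x : nat -> R[i]^o) : nat -> R[i]^o :=
  fun k => k.+1%:R^-1 * \sum_(0 <= j < k.+1) x j.

Lemma le_normc_sum (R : realType) (I : Type) (r : seq I) (F : I -> R[i]) :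
  normc (\sum_(j <- r) F j) <= \sum_(j <- r) normc (F j).
Proof.
elim: r => [|j r IH]; first by rewrite !big_nil normc0.
by rewrite !big_cons (le_trans (le_normcD _ _)) // lerD2l.
Qed.

Lemma normc_nat (R : realType) (n : nat) : normc (n%:R : R[i]) = n%:R.
Proof. by rewrite normcMn normc1. Qed.

Lemma cesaro_seq_cvg (R : realType) (x : cseq R) :
  cesaro_seq x \in @cvg_seq R.
Proof.
have /asboolP /cvg_ex[l /cvg_normcP xl] := cseq_cvg x.
apply/asboolP/cvg_ex; exists l; apply/cvg_normcP.
apply: (squeeze_cvgr _ (cvg_cst 0) (cesaro xl)); near=> n; apply/andP; split.
  by case: (_ - _) => a b /=; exact: sqrtr_ge0.
rewrite /arithmetic_mean seriesEnat /=.
have -> : l - cesaro_seq x n =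
    n.+1%:R^-1 * \sum_(0 <= j < n.+1) (l - x j) :> R[i].
  rewrite big_split /= sumrN sumr_const_nat subn0 mulrBr -(mulr_natl l).
  by rewrite mulKf // pnatr_eq0.
rewrite normcM normcV normc_nat ler_wpM2l ?invr_ge0 ?ler0n //.
exact: le_normc_sum.
Unshelve. all: by end_near. Qed.

Definition cesaro_op (R : realType) (x : cseq R) : cseq R :=
  CSeq (cesaro_seq_cvg x).

Lemma cst_cvg_seq (R : realType) (a : R[i]^o) :
  (fun=> a : R[i]^o) \in @cvg_seq R.
Proof. by apply/asboolP; exact: is_cvg_cst. Qed.

Definition e_infty (R : realType) : cseq R := CSeq (cst_cvg_seq 1).

Definition P_op (R : realType) (x : cseq R) : cseq R := x 0%N *: e_infty R.

(* Main.v *)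
Require Import Defs.
From HB Require Import structures.
From mathcomp Require Import all_boot all_order all_algebra.
From mathcomp Require Import complex ring lra.
From mathcomp Require Import all_classical all_reals all_analysis.

(* Writing [z_k = (x_k - x_0) + \sum_(1 <= i <= k) (x_i - x_0) / i], which is a
   convergent sequence, one has [x - P x = (I - T) z] and hence
   [T^n x - P x = (T^n - T^(n+1)) z], so it suffices that the rows of
   [T^n - T^(n+1)] have l^1 norm at most [n^(-1/2)].  The (k, j) entry [a_n] of
   [T^n] is [h_(n-1)(1/(j+1), ..., 1/(k+1)) / (k+1)], with [h_m] the complete
   homogeneous symmetric polynomial, and [m! h_m] is log-convex in [m] at
   positive arguments (it is the m-th moment of a sum of independent
   exponential variables), that is [n a_(n+1)^2 <= (n+1) a_n a_(n+2)].  Since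
   the rows of every [T^m] sum to 1, this turns into the l^1 bound by
   AM-GM.  The log-convexity is proved by adding the arguments of [h_m] one at
   a time. *)

Set Implicit Arguments.
Unset Strict Implicit.
Unset Printing Implicit Defensive.

Import Order.TTheory GRing.Theory Num.Theory.
Import numFieldNormedType.Exports.
Import Normc.
Local Open Scope classical_set_scope.
Local Open Scope ring_scope.
Local Open Scope complex_scope.

(** * Complete homogeneous polynomials: adding one argument *)

Section AddVariable.
Variables (R : realFieldType).

(* The last clause says that [n! h_n] is log-convex. *)
Definition newton_seq (h : nat -> R) :=
  [/\ forall n, 0 < h n,
      forall n, h n * h n.+2 <= h n.+1 ^+ 2
    & forall n, n.+1%:R * h n.+1 ^+ 2 <= n.+2%:R * (h n * h n.+2)].

Lemma newton_seq_geometric (y : R) : 0 < y -> newton_seq (fun n => y ^+ n).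
Proof.
move=> y0; have E n : y ^+ n * y ^+ n.+2 = y ^+ n.+1 ^+ 2.
  by rewrite -exprD -exprM; congr (_ ^+ _); rewrite muln2 -addnn !addnS.
split=> n; first exact: exprn_gt0; first by rewrite E.
by rewrite E ler_wpM2r ?ler_nat // exprn_ge0 // exprn_ge0 // ltW.
Qed.

Variables (y : R) (h g : nat -> R).
Hypotheses (y_gt0 : 0 < y) (hN : newton_seq h).
(* If [h n] is [h_n(y_1, ..., y_r)] then [g n] is [h_n(y_1, ..., y_r, y)]. *)
Hypotheses (g0 : g 0%N = h 0%N) (gS : forall n, g n.+1 = h n.+1 + y * g n).

Let h_gt0 n : 0 < h n. Proof. by case: hN. Qed.

Lemma add_var_gt0 n : 0 < g n.
Proof.
elim: n => [|n IH]; first by rewrite g0.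
by rewrite gS addr_gt0 // mulr_gt0.
Qed.

(** That is, [g / h] is nondecreasing. After cancelling [h n.+1 * h n.+2], the induction step is
    [g n * h n.+2 <= g n.+1 * h n.+1], which follows from the log-concavity of [h]; hence that
    clause in [newton_seq]. *)
Lemma add_var_ratio n : g n * h n.+1 <= g n.+1 * h n.
Proof.
case: hN => _ hlc _; elim: n => [|n IH].
  by rewrite gS g0; have := mulr_gt0 y_gt0 (mulr_gt0 (h_gt0 0) (h_gt0 0)); nra.
have h1 := h_gt0 n.+1; have h3 := h_gt0 n; have gn := add_var_gt0 n.
rewrite (gS n.+1) {1}gS !mulrDl [h n.+1 * _]mulrC lerD2l -!mulrA ler_pM2l //.
rewrite -(ler_pM2r h3); apply: (@le_trans _ _ (g n * h n.+1 ^+ 2)).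
  by rewrite -mulrA ler_pM2l // [h n.+2 * _]mulrC hlc.
by have := ler_wpM2r (ltW h1) IH; lra.
Qed.

Lemma add_var_log_concave n : g n * g n.+2 <= g n.+1 ^+ 2.
Proof.
case: hN => _ hlc _.
have h1 := h_gt0 n.+1; have g1 := add_var_gt0 n.+1.
have key : g n * h n.+2 <= g n.+1 * h n.+1.
  rewrite -(ler_pM2r h1); apply: (@le_trans _ _ (g n.+1 * (h n * h n.+2))).
    by have := ler_wpM2r (ltW (h_gt0 n.+2)) (add_var_ratio n); lra.
  by rewrite -mulrA -expr2 ler_pM2l.
have -> : g n.+1 ^+ 2 = g n.+1 * h n.+1 + y * g n * g n.+1.
  by rewrite expr2 {2}gS; ring.
by rewrite (gS n.+1); lra.
Qed.

(* [euler n] is [\sum_i (n - i) y^i h_(n-i)], so that [n.+1 * g n - euler n] is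
   [h_n(y_1, ..., y_r, y, y)]. *)
Fixpoint euler n : R := if n is m.+1 then m.+1%:R * h m.+1 + y * euler m else 0.

(** Log-concavity in the number of copies of [y]. The first factor [s n] satisfies
    [s n.+1 = g n.+1 + y * s n], and [add_var_ratio] carries the induction. *)
Lemma add_var_twice n : (n.+1%:R * g n - euler n) * h n <= g n ^+ 2.
Proof.
elim: n => [|n IH]; first by rewrite /= g0 expr2; nra.
have hn := h_gt0 n; have h1 := h_gt0 n.+1; have gn := add_var_gt0 n.
have g1 := add_var_gt0 n.+1; have rt := add_var_ratio n.
have -> : n.+2%:R * g n.+1 - euler n.+1 =
  g n.+1 + y * (n.+1%:R * g n - euler n).
  by rewrite /= gS -[n.+2]addn1 natrD; ring.
set s := (_ - _) in IH *.
have yg : y * g n = g n.+1 - h n.+1 by rewrite gS; ring.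
have : y * s * h n.+1 <= (g n.+1 - h n.+1) * g n.+1.
  have A := ler_wpM2r (ltW h1) IH; have B := ler_wpM2l (ltW gn) rt.
  by rewrite -yg -(ler_pM2r hn) -!mulrA ler_pM2l //; lra.
by nra.
Qed.

(** Expanded in powers of [y], this holds term by term because [m * h m / h (m - 1)] increases with
    [m], by log-convexity of [m! h_m]. *)
Lemma euler_le n : euler n.+1 * h n.+1 <= n.+2%:R * (g n * h n.+2).
Proof.
case: hN => _ _ hlx; elim: n => [|n IH].
  by have := hlx 0%N; rewrite /= g0; lra.
have hn := h_gt0 n.+1; have h2 := h_gt0 n.+2; have gn := add_var_gt0 n.
have -> : euler n.+2 = n.+2%:R * h n.+2 + y * euler n.+1 by [].
rewrite gS; have L := hlx n.+1.
have A := ler_wpM2r (ltW (mulr_gt0 y_gt0 h2)) IH.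
have B := ler_wpM2r (ltW (mulr_gt0 y_gt0 gn)) L.
have C := ler_wpM2r (ltW hn) L.
by rewrite -(ler_pM2r hn); move: (euler n.+1) A => e A; lra.
Qed.

Lemma newton_seq_add_var : newton_seq g.
Proof.
split=> [||n]; [exact: add_var_gt0 | exact: add_var_log_concave |].
have A := add_var_twice n.+1; have B := euler_le n.
have E : y * g n = g n.+1 - h n.+1 by rewrite gS; ring.
have -> : g n * g n.+2 = g n * h n.+2 + (g n.+1 - h n.+1) * g n.+1.
  by rewrite -E (gS n.+1); ring.
(* Adding [A] and [B] eliminates [euler n.+1]; the terms in [g n.+1 * h n.+1] then cancel. *)
move: (euler _) A B => e; rewrite -[n.+2]addn1 natrD => A B.
by nra.
Qed.

End AddVariable.

(* With [q = a - 2 b + (1 + c^2) d], the hypothesis reads [(a - b)^2 <= a q],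
   hence [|a - b| <= (c a + q / c) / 2] by AM-GM, and [q] sums to [c^2]. *)
Lemma sum_norm_sub_le (R : realFieldType) (N : nat) (a b d : 'I_N -> R)
    (c : R) :
  0 < c -> (forall j, 0 <= a j) -> (forall j, 0 <= d j) ->
  \sum_j a j = 1 -> \sum_j b j = 1 -> \sum_j d j = 1 ->
  (forall j, b j ^+ 2 <= (1 + c ^+ 2) * (a j * d j)) ->
  \sum_j `|a j - b j| <= c.
Proof.
move=> c0 a0 d0 sa sb sd abd.
pose q j := a j - 2 * b j + (1 + c ^+ 2) * d j.
have -> : c = \sum_j 2^-1 * (c * a j + c^-1 * q j).
  rewrite -mulr_sumr big_split /= -!mulr_sumr /q big_split /= sumrB -!mulr_sumr.
  by rewrite sa sb sd; field; rewrite gt_eqF.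
apply: ler_sum => j _.
have dq : (a j - b j) ^+ 2 <= a j * q j by have := abd j; rewrite /q; nra.
(* If [a j = 0], then [dq] says nothing about the sign of [q j], but the hypothesis forces
   [b j = 0]. *)
have q0 : 0 <= q j.
  have [a_gt0|a_le0] := ltP 0 (a j).
    by rewrite -(pmulr_rge0 _ a_gt0) (le_trans _ dq) // sqr_ge0.
  have aE : a j = 0 by apply/le_anti; rewrite a0 a_le0.
  have bE : b j = 0.
    apply/eqP; rewrite -sqrf_eq0; apply/eqP/le_anti; rewrite sqr_ge0 andbT.
    by rewrite (le_trans (abd j)) // aE mul0r mulr0.
  by rewrite /q aE bE mulr0 subrr add0r mulr_ge0 // addr_ge0 // sqr_ge0.
have S0 : 0 <= 2^-1 * (c * a j + c^-1 * q j).
  by rewrite mulr_ge0 ?invr_ge0 // addr_ge0 // mulr_ge0 ?invr_ge0 // ltW.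
rewrite -(ger0_norm S0) -ler_sqr ?nnegrE //.
rewrite !real_normK ?num_real // (le_trans dq) //.
have -> : a j * q j = (c * a j) * (c^-1 * q j) by field; rewrite gt_eqF.
have := sqr_ge0 (c * a j - c^-1 * q j).
by move: (c * a j) (c^-1 * q j) => u v; lra.
Qed.

(** * Entries of the powers of the Cesaro matrix *)

Section CesaroMatrix.
Variable R : realFieldType.

(* The (k, j) entry of the n-th power of the matrix of the Cesaro operator. *)
Fixpoint cesaro_mx (n k j : nat) : R :=
  if n is m.+1 then k.+1%:R^-1 * \sum_(l < k.+1) cesaro_mx m l j
  else (k == j)%:R.

Lemma cesaro_mx_ge0 n k j : 0 <= cesaro_mx n k j.
Proof.
elim: n k => [|n IH] k /=; first exact: ler0n.
by rewrite mulr_ge0 ?invr_ge0 ?ler0n // sumr_ge0.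
Qed.

Lemma cesaro_mx_eq0 n k j : (k < j)%N -> cesaro_mx n k j = 0.
Proof.
elim: n k => [|n IH] k kj /=; first by rewrite ltn_eqF.
by rewrite big1 ?mulr0 // => l _; rewrite IH // (leq_ltn_trans _ kj) // -ltnS.
Qed.

Lemma cesaro_mx_row_sum n k N : (k < N)%N -> \sum_(j < N) cesaro_mx n k j = 1.
Proof.
elim: n k => [|n IH] k kN /=.
  rewrite (bigD1 (Ordinal kN)) //= eqxx big1 ?addr0 // => j /eqP jk.
  by case: eqP => // kj; case: jk; apply: val_inj.
rewrite -mulr_sumr exchange_big /=.
under eq_bigr => l _ do rewrite IH ?(leq_trans (ltn_ord l)) //.
by rewrite sumr_const card_ord mulVf // pnatr_eq0.
Qed.

Lemma cesaro_mxS n k j :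
  k.+1%:R * cesaro_mx n.+1 k j = \sum_(l < k.+1) cesaro_mx n l j.
Proof. by rewrite /= mulVKf // pnatr_eq0. Qed.

Arguments cesaro_mx : simpl never.

(** This is the recursion [gS] for the new argument [1/(k+2)]: for positive [n] the last term is
    that argument times the left-hand side at [n - 1]. *)
Lemma cesaro_mx_rec n k j : k.+2%:R * cesaro_mx n.+1 k.+1 j =
  k.+1%:R * cesaro_mx n.+1 k j + cesaro_mx n k.+1 j.
Proof. by rewrite !cesaro_mxS big_ord_recr. Qed.

(* The sequence is h_n(1/(j+1), ..., 1/(k+1)). *)
Lemma newton_seq_cesaro_mx k j : (j <= k)%N ->
  newton_seq (fun n => k.+1%:R * cesaro_mx n.+1 k j).
Proof.
elim: k => [|k IH].
  rewrite leqn0 => /eqP ->.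
  have -> : (fun n => 1 * cesaro_mx n.+1 0 0) = (fun n => 1 ^+ n).
    apply/funext => n; rewrite mul1r expr1n.
    by have := cesaro_mx_row_sum n.+1 (ltnSn 0); rewrite big_ord1.
  exact: newton_seq_geometric.
have k0 : 0 < k.+2%:R^-1 :> R by rewrite invr_gt0.
(* On the diagonal [1/(k+2)] is the only argument, so the sequence is geometric; below it, one
   argument is added to row [k]. *)
rewrite leq_eqVlt => /predU1P[->|jk].
  have -> : (fun n => k.+2%:R * cesaro_mx n.+1 k.+1 k.+1) =
            (fun n => k.+2%:R^-1 ^+ n).
    apply/funext; elim=> [|n IHn].
      by rewrite cesaro_mx_rec cesaro_mx_eq0 // mulr0 add0r /cesaro_mx eqxx.
    rewrite exprS -IHn cesaro_mx_rec cesaro_mx_eq0 // mulr0 add0r.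
    by rewrite mulKf.
  exact: newton_seq_geometric.
apply: (newton_seq_add_var k0 (IH jk)) => [|n].
  by rewrite cesaro_mx_rec /(cesaro_mx 0) gtn_eqF // addr0.
by rewrite cesaro_mx_rec mulKf // pnatr_eq0.
Qed.

Lemma cesaro_mx_log_convex n k j :
  n.+1%:R * cesaro_mx n.+2 k j ^+ 2 <=
  n.+2%:R * (cesaro_mx n.+1 k j * cesaro_mx n.+3 k j).
Proof.
have [jk|kj] := leqP j k; last by rewrite !cesaro_mx_eq0 // expr0n !mulr0.
have [_ _ /(_ n)] := newton_seq_cesaro_mx jk.
have k0 : 0 < k.+1%:R ^+ 2 :> R by rewrite exprn_gt0.
rewrite exprMn mulrCA [k.+1%:R * _ * _]mulrACA -expr2 [leRHS]mulrCA.
by rewrite (ler_pM2l k0).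
Qed.

(** The choice of [c] makes [1 + c^2] equal to [(n+2)/(n+1)], the constant in the log-convexity of
    three consecutive powers. *)
Lemma cesaro_mx_variation n k N (c : R) : (k < N)%N -> 0 < c ->
  c ^+ 2 = n.+1%:R^-1 ->
  \sum_(j < N) `|cesaro_mx n.+1 k j - cesaro_mx n.+2 k j| <= c.
Proof.
move=> kN c0 cE.
have row m := cesaro_mx_row_sum m kN.
apply: (sum_norm_sub_le c0 _ _ (row _) (row _) (row n.+3)) => j;
  rewrite ?cesaro_mx_ge0 //.
have n0 : 0 < n.+1%:R :> R by [].
rewrite -(ler_pM2l n0) (le_trans (cesaro_mx_log_convex n k j)) //.
by rewrite [leRHS]mulrA mulrDr mulr1 cE mulfV ?gt_eqF // natr1.
Qed.

End CesaroMatrix.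

(** * From matrix rows to the operator on [c] *)

Lemma cesaro_seq_iter (R : realType) (x : cseq R) n k N : (k < N)%N ->
  iter n (@cesaro_op R) x k = \sum_(j < N) (cesaro_mx R n k j)%:C * x j :> R[i].
Proof.
elim: n k => [|n IH] k kN.
  rewrite (bigD1 (Ordinal kN)) //= eqxx mul1r big1 ?addr0 // => j /eqP jk.
  by case: eqP => [kj|_]; [case: jk; apply: val_inj | rewrite mul0r].
rewrite iterS /= /cesaro_seq big_mkord.
(* Since [N] is independent of the row, all rows [l <= k] share one range and the sums can be
   exchanged. *)
rewrite (eq_bigr _ (fun (l : 'I_k.+1) _ => IH l (leq_trans (ltn_ord l) kN))).
rewrite exchange_big /= mulr_sumr; apply: eq_bigr => j _.
rewrite -mulr_suml mulrA rmorphM fmorphV /= rmorph_nat; congr (_ * _ * _).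
by rewrite rmorph_sum.
Qed.

Lemma cesaro_opB (R : realType) (x y : cseq R) :
  cesaro_op (x - y) = cesaro_op x - cesaro_op y.
Proof.
apply: val_inj; apply/funext => k /=.
rewrite /cesaro_seq -[RHS]/(_ * _ - _ * _ : R[i]) -mulrBr -sumrB.
by congr (_ * _).
Qed.

Lemma le_normc_supnorm (R : realType) (x : cseq R) k : normc (x k) <= supnorm x.
Proof. by apply: (ub_le_sup (proj2 (has_sup_normc x))); exists k. Qed.

Lemma supnorm_ge0 (R : realType) (x : cseq R) : 0 <= supnorm x.
Proof.
apply: le_trans (le_normc_supnorm x 0%N).
by case: (x 0%N) => a b; exact: sqrtr_ge0.
Qed.

Lemma supnorm_cesaro_iter_diff (R : realType) (z : cseq R) n :
  supnorm (iter n.+1 (@cesaro_op R) z - iter n.+2 (@cesaro_op R) z) <=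
  supnorm z * n.+1%:R `^ (- 2^-1).
Proof.
set c := _ `^ _.
have c0 : 0 < c by rewrite powR_gt0.
have cE : c ^+ 2 = n.+1%:R^-1.
  by rewrite -powR_mulrn ?powR_ge0 // -powRrM mulNr mulVf // powR_inv1.
apply: ge_sup => [|_ [k _ <-]]; first exact: (proj1 (has_sup_normc _)).
have -> : (iter n.+1 (@cesaro_op R) z - iter n.+2 (@cesaro_op R) z) k =
  \sum_(j < k.+1) (cesaro_mx R n.+1 k j - cesaro_mx R n.+2 k j)%:C * z j
  :> R[i].
  rewrite -[LHS]/(iter n.+1 (@cesaro_op R) z k -
                  iter n.+2 (@cesaro_op R) z k : R[i]).
  rewrite !(cesaro_seq_iter _ _ (ltnSn k)) -sumrB; apply: eq_bigr => j _.
  by rewrite rmorphB mulrBl.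
apply: le_trans (le_normc_sum _ _) _.
apply: (@le_trans _ _ (\sum_(j < k.+1)
   supnorm z * `|cesaro_mx R n.+1 k j - cesaro_mx R n.+2 k j|)).
  apply: ler_sum => j _; rewrite normcM mulrC.
  have -> (a : R) : normc a%:C = `|a|.
    by rewrite /normc /= expr0n /= addr0 sqrtr_sqr.
  by rewrite ler_wpM2r // le_normc_supnorm.
by rewrite -mulr_sumr ler_wpM2l ?supnorm_ge0 ?(cesaro_mx_variation (ltnSn k)).
Qed.

Lemma cesaro_op_P (R : realType) (x : cseq R) : cesaro_op (P_op x) = P_op x.
Proof.
apply: val_inj; apply/funext => k /=.
rewrite /cesaro_seq sumr_const_nat subn0 -[X in _ * X]mulr_natl.
by rewrite mulKf // pnatr_eq0.
Qed.

(* Solving [(I - T) z = x - P x] for the Cesaro means of [z] gives the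
   partial sums of the series. *)
Lemma range_one_minus_cesaro (R : realType) (x : cseq R) :
  cvgn (fun n : nat => \sum_(1 <= k < n.+1) (x k - x 0%N) / k%:R : R[i]^o) ->
  exists z : cseq R, x = P_op x + (z - cesaro_op z).
Proof.
move=> cs; pose s n : R[i]^o := \sum_(1 <= k < n.+1) (x k - x 0%N) / k%:R.
have sP : s \in @cvg_seq R by apply/asboolP.
pose z := x - P_op x + CSeq sP.
have zE k : z k = x k - x 0%N + s k :> R[i].
  by rewrite -[LHS]/(x k - x 0%N * 1 + s k : R[i]) mulr1.
exists z; clearbody z.
have mz k : \sum_(0 <= j < k.+1) z j = k.+1%:R * s k.
  elim: k => [|k IH].
    by rewrite big_nat1 zE subrr add0r mul1r.
  rewrite big_nat_recr //= IH zE.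
  have -> : s k.+1 = s k + (x k.+1 - x 0%N) / k.+1%:R.
    by rewrite /s big_nat_recr.
  have k0 : k.+1%:R != 0 :> R[i] by rewrite pnatr_eq0.
  have -> : k.+2%:R = k.+1%:R + 1 :> R[i] by rewrite natr1.
  have E (a b m : R[i]) : m != 0 ->
      m * a + (b + (a + b / m)) = (m + 1) * (a + b / m).
    by move=> m0; field.
  exact: E.
apply: val_inj; apply/funext => k.
rewrite -[RHS]/(x 0%N * 1 + (z k - cesaro_seq z k) : R[i]) /cesaro_seq mz.
rewrite mulKf ?pnatr_eq0 // zE mulr1.
have E (a b c : R[i]) : a = b + (a - b + c - c) by ring.
exact: E.
Qed.

Theorem theorem3p2 (R : realType) (x : cseq R)
  (x_lim : x k @[k --> \oo] --> x 0%N)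
  (x_series : cvgn (fun n : nat =>
     \sum_(1 <= k < n.+1) (x k - x 0%N) / k%:R : R[i]^o)) :
  (fun n : nat => supnorm (iter n (@cesaro_op R) x - P_op x))
    =O_\oo (fun n : nat => n%:R `^ (- 2^-1)).
Proof.
have [z xE] := range_one_minus_cesaro x_series.
have iterE n : iter n (@cesaro_op R) x - P_op x =
    iter n (@cesaro_op R) z - iter n.+1 (@cesaro_op R) z.
  elim: n => [|n IH]; first by rewrite /= {1}xE addrC addKr.
  by rewrite iterS -(cesaro_op_P x) -cesaro_opB IH cesaro_opB.
(* The added 1 makes the constant positive even when [z = 0]. The bound starts at [n = 1], since
   [powR] sends 0 to 0 at exponent -1/2. *)
apply/eqO_exP; exists (supnorm z + 1).
  by rewrite ltr_wpDl ?supnorm_ge0.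
exists 1%N => // -[//|n] _ /=.
rewrite -iterS iterE (ger0_norm (supnorm_ge0 _)) (ger0_norm (powR_ge0 _ _)).
rewrite (le_trans (supnorm_cesaro_iter_diff z n)) //.
by rewrite ler_wpM2r ?powR_ge0 // lerDl.
Qed.
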